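(* Consider a homogeneous quantum network, i.e. a network in which all edges carry identical entangled states, namely the same isotropic state $\rho(p)=\frac{1-p}{4}\mathbb{I}+p\,|\Phi^+\rangle\langle\Phi^+|$ with visibility $p\in(0,1)$. Let $S\neq T$ be any two nodes of the network, let $n\ge 3$, and let $\mathcal{R}_1,\dots,\mathcal{R}_n$ be the distinct paths between $S$ and $T$ used for purification, listed in order of length, $\ell_1\le\ell_2\le\dots\le\ell_n$. Let $f_i=\frac14\left(1+3p^{\ell_i}\right)$ be the fidelity of the end-to-end state between $S$ and $T$ obtained by entanglement swapping along $\mathcal{R}_i$, with $f_i\in(\frac12,1)$ for all $i$. Then the shortest-path-last (SPL) sequential purification strategy provides higher output fidelity than the shortest-path-first (SPF) strategy, that is, $$\mathcal{L}(f_n,f_{n-1},\dots,f_1)>\mathcal{L}(f_1,f_2,\dots,f_n).$$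
   Context: Network and swapping: a quantum network is a graph whose edges represent entangled two-qubit states shared by adjacent nodes; here $|\Phi^+\rangle=(|00\rangle+|11\rangle)/\sqrt2$ and the fidelity of a two-qubit state $\rho$ is $\langle\Phi^+|\rho|\Phi^+\rangle$, which equals $\frac14(1+3p)$ for $\rho(p)$. The length of a path is its number of edges. Entanglement swapping along a path with $\ell$ edges, each carrying $\rho(p)$, yields the end-to-end isotropic state $\rho(p^{\ell})$, whose fidelity is $\frac14(1+3p^{\ell})$. Purification: the purification of two states with fidelities $x,y\in(\frac12,1)$ outputs a state of fidelity $$\mathcal{P}_D(x,y)=\frac{10xy-x-y+1}{8xy-2x-2y+5}.$$ For $x_1,\dots,x_n\in(\frac12,1)$, sequential purification in the given order has output fidelity $$\mathcal{L}(x_1,x_2,\dots,x_n)=\mathcal{P}_D(\dots\mathcal{P}_D(\mathcal{P}_D(x_1,x_2),x_3),\dots,x_n),$$ i.e. $\mathcal{L}(x_1,x_2)=\mathcal{P}_D(x_1,x_2)$ and $\mathcal{L}(x_1,\dots,x_{k+1})=\mathcal{P}_D(\mathcal{L}(x_1,\dots,x_k),x_{k+1})$. Strategies: SPL purifies the end-to-end states in order of decreasing path length (longest paths first, shortest path last), so its output fidelity is $\mathcal{L}(f_n,f_{n-1},\dots,f_1)$; SPF purifies in order of increasing path length, so its output fidelity is $\mathcal{L}(f_1,f_2,\dots,f_n)$.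
   Formalization: The formal theorem additionally assumes that the path lengths are not all equal (ℓ_1 < ℓ_n); if all lengths coincide, all f_i are equal and the two strategies give the same output fidelity, so the strict inequality fails. *)

(* Defs.v *)
From mathcomp Require Import all_boot all_order all_algebra.
From mathcomp Require Import complex.
From mathcomp Require Import ring.

Set Implicit Arguments.
Unset Strict Implicit.
Unset Printing Implicit Defensive.

Import Order.TTheory GRing.Theory Num.Theory.

Local Open Scope ring_scope.
Local Open Scope complex_scope.

Section States.
Variable R : rcfType.

(* Two-qubit operators are written in the computational basis
   |00>, |01>, |10>, |11>, indexed in this order by 'I_4; so |00> and |11>
   are the indices ord0 and ord_max. *)
Definition ket_Phi : 'cV[R[i]]_4 :=
  ((Num.sqrt 2)^-1)%:C *: (delta_mx ord0 ord0 + delta_mx ord_max ord0).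

Definition bra_Phi : 'rV[R[i]]_4 := map_mx (@conjc R) ket_Phi^T.

Definition isotropic (p : R) : 'M[R[i]]_4 :=
  ((1 - p) / 4)%:C *: 1%:M + p%:C *: (ket_Phi *m bra_Phi).

(* <Phi+|rho|Phi+> is real when rho is Hermitian, so taking its real part
   loses nothing. *)
Definition fidelity (rho : 'M[R[i]]_4) : R :=
  complex.Re ((bra_Phi *m rho *m ket_Phi) ord0 ord0).

Lemma bra_ket_Phi : bra_Phi *m ket_Phi = 1%:M.
Proof.
have s2 : Num.sqrt 2 * Num.sqrt 2 = 2 :> R by rewrite -expr2 sqr_sqrtr ?ler0n.
have s20 : Num.sqrt 2 != 0 :> R by rewrite sqrtr_eq0 -ltNge ltr0n.
apply/matrixP => i j; rewrite !ord1 !mxE !big_ord_recl big_ord0 !mxE /=.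
apply/eqP; rewrite eq_complex /=; apply/andP; split; apply/eqP; last by ring.
rewrite !(mulr0, mul0r, mulr1, addr0, add0r, subr0, oppr0).
rewrite -invfM s2.
by field.
Qed.

Lemma fidelity_isotropic (p : R) : fidelity (isotropic p) = (1 + 3 * p) / 4.
Proof.
rewrite /fidelity /isotropic; move: ket_Phi bra_Phi bra_ket_Phi => k b bk.
rewrite mulmxDr mulmxDl -!scalemxAr -!scalemxAl mulmx1.
rewrite mulmxA bk mul1mx bk !mxE /=.
by field.
Qed.

End States.

Section Network.
Variables (R : rcfType) (V : finType).

(* A path leaving S is given by the sequence r of the vertices visited after
   S, so that size r is its number of edges. *)
Definition is_path (e : rel V) (S T : V) (r : seq V) : bool :=
  [&& path e S r, last S r == T & uniq (S :: r)].

(* Swapping along a path with l edges, each carrying isotropic p, multiplies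
   the visibilities. *)
Definition swapped_state (p : R) (r : seq V) : 'M[R[i]]_4 :=
  isotropic (p ^+ size r).

Definition path_fidelity (p : R) (r : seq V) : R :=
  fidelity (swapped_state p r).

Lemma path_fidelityE (p : R) (r : seq V) :
  path_fidelity p r = (1 + 3 * p ^+ size r) / 4.
Proof. exact: fidelity_isotropic. Qed.

End Network.

Section Purification.
Variable R : rcfType.

Definition purify (x y : R) : R :=
  (10 * x * y - x - y + 1) / (8 * x * y - 2 * x - 2 * y + 5).

(* The value on the empty sequence is a dummy. *)
Definition seq_purify (s : seq R) : R :=
  if s is x :: s' then foldl purify x s' else 0.

(* Both strategies take the fidelities listed by increasing path length. *)
Definition SPF (f : seq R) : R := seq_purify f.

Definition SPL (f : seq R) : R := seq_purify (rev f).

End Purification.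

(* Main.v *)
(** In terms of visibilities [a], defined by fidelity [= (1 + 3 a) / 4],
    purification becomes [a * b = (a + b + 4ab) / (3 (1 + ab))].  It is
    commutative and strictly increasing in each argument on the unit interval,
    and [(z * x) * y <= (z * y) * x] as soon as [y <= x]: among the inputs
    purified after the first one, it pays to use the larger one later.  Moving
    the largest input from the first to the last place therefore improves the
    output, strictly so if some input outside the first two is smaller, and
    repeating this on the remaining inputs reverses the order. *)
Require Import Defs.
From mathcomp Require Import all_boot all_order all_algebra.
From mathcomp Require Import complex ring lra.

Set Implicit Arguments.
Unset Strict Implicit.
Unset Printing Implicit Defensive.

Import Order.TTheory GRing.Theory Num.Theory.

Local Open Scope ring_scope.

Section Visibility.
Variable R : rcfType.
Implicit Types (a b x y z : R) (s t : seq R).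

Definition isofid a : R := (1 + 3 * a) / 4.

Definition vpurify a b : R := (a + b + 4 * a * b) / (3 * (1 + a * b)).

Lemma vpurifyC : commutative vpurify.
Proof. by move=> a b; rewrite /vpurify; congr (_ / _); ring. Qed.

Lemma vpurify_gt0 a b : 0 < a -> 0 < b -> 0 < vpurify a b.
Proof. by move=> a0 b0; rewrite /vpurify divr_gt0 //; nra. Qed.

Lemma purify_isofid a b : 0 < a -> 0 < b ->
  purify (isofid a) (isofid b) = isofid (vpurify a b).
Proof.
move=> a0 b0; rewrite /purify /isofid /vpurify.
by field; apply/andP; split; rewrite gt_eqF //; nra.
Qed.

Lemma foldl_purify z s : 0 < z -> all (> 0) s ->
  foldl (@purify R) (isofid z) (map isofid s) = isofid (foldl vpurify z s).
Proof.
elim: s z => //= x s IHs z z0 /andP[x0 s0].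
by rewrite purify_isofid // IHs // vpurify_gt0.
Qed.

Lemma ltr_isofid : {mono isofid : a b / a < b}.
Proof. by move=> a b; rewrite /isofid ltr_pM2r ?invr_gt0 // ltrD2l ltr_pM2l. Qed.

Lemma ltr_vpurifyl b : 0 < b < 1 ->
  {in Num.pos &, {homo vpurify^~ b : x y / x < y}}.
Proof.
move=> /andP[b0 b1] x y; rewrite !posrE => x0 y0 ltxy; rewrite -subr_gt0.
have -> : vpurify y b - vpurify x b =
    (y - x) * (1 + 4 * b - b ^+ 2) / (3 * (1 + x * b) * (1 + y * b)).
  by rewrite /vpurify; field; apply/andP; split; rewrite gt_eqF //; nra.
have ? : 0 < x * b by rewrite mulr_gt0.
have ? : 0 < y * b by rewrite mulr_gt0.
by rewrite divr_gt0 ?mulr_gt0 //; nra.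
Qed.

Lemma ler_vpurifyl b : 0 < b < 1 ->
  {in Num.pos &, {homo vpurify^~ b : x y / x <= y}}.
Proof.
move=> b01 x y x0 y0; rewrite le_eqVlt => /predU1P[-> //|ltxy].
exact/ltW/ltr_vpurifyl.
Qed.

Lemma vpurify_swap z x y : 0 < z -> 0 < x -> 0 < y -> y < x ->
  vpurify (vpurify z x) y < vpurify (vpurify z y) x.
Proof.
move=> z0 x0 y0 ltyx; rewrite -subr_gt0.
have vv a b c : 0 < a -> 0 < b -> 0 < c -> vpurify (vpurify a b) c =
    (a + b + 3 * c + 4 * (a * b + a * c + b * c) + 19 * (a * b * c)) /
    (3 * (3 + 3 * (a * b) + a * c + b * c + 4 * (a * b * c))).
  move=> a0 b0 c0.
  have ? : 0 < a * b by rewrite mulr_gt0.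
  have ? : 0 < a * c by rewrite mulr_gt0.
  have ? : 0 < b * c by rewrite mulr_gt0.
  have ? : 0 < a * b * c by rewrite !mulr_gt0.
  rewrite /vpurify; field; do ?(apply/andP; split); rewrite gt_eqF //; lra.
have ? : 0 < z * x by rewrite mulr_gt0.
have ? : 0 < z * y by rewrite mulr_gt0.
have ? : 0 < x * y by rewrite mulr_gt0.
have ? : 0 < z * x * y by rewrite !mulr_gt0.
have ? : 0 < z * y * x by rewrite !mulr_gt0.
rewrite !vv //.
set n1 := (X in X / _ - _); set d1 := (X in n1 / X - _).
set n2 := (X in _ - X / _); set d2 := (X in _ - n2 / X).
have d10 : 0 < d1 by rewrite /d1; lra.
have d20 : 0 < d2 by rewrite /d2; lra.
rewrite subr_gt0 ltr_pdivrMr // mulrAC ltr_pdivlMr // -subr_gt0.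
(* [n1 = N + 2 y], [d1 = 3 (M + 2 z x)], and symmetrically for [n2], [d2]. *)
pose N := z + x + y + 4 * (z * x + z * y + x * y) + 19 * (z * x * y).
pose M := 3 + z * x + z * y + x * y + 4 * (z * x * y).
have -> : n1 * d2 - n2 * d1 = 6 * (x - y) * (M + z * N + 2 * z * (x + y)).
  by rewrite /n1 /n2 /d1 /d2 /N /M; ring.
have N0 : 0 < N by rewrite /N; lra.
have M0 : 0 < M by rewrite /M; lra.
by rewrite !mulr_gt0 ?subr_gt0 // !addr_gt0 // !mulr_gt0 // addr_gt0.
Qed.

Lemma foldl_vpurify_gt0 z s : 0 < z -> all (> 0) s -> 0 < foldl vpurify z s.
Proof.
elim: s z => //= x s IHs z z0 /andP[x0 s0].
by rewrite IHs // vpurify_gt0.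
Qed.

Definition visibility x := 0 < x < 1.

Lemma visibility_gt0 x : visibility x -> 0 < x.
Proof. by rewrite /visibility => /andP[]. Qed.

Lemma all_visibility_gt0 s : all visibility s -> all (> 0) s.
Proof. by apply: sub_all => x; apply: visibility_gt0. Qed.

Lemma ltr_foldl_vpurify s : all visibility s ->
  {in Num.pos &, {homo foldl vpurify^~ s : x y / x < y}}.
Proof.
elim: s => [_ x y //|b s IHs /andP[b01 s01] x y x0 y0 ltxy].
have b0 := visibility_gt0 b01.
by apply: IHs; rewrite ?posrE ?vpurify_gt0 //; apply: ltr_vpurifyl.
Qed.

Lemma foldl_vpurify_rcons z x s : 0 < z -> 0 < x ->
  all visibility s -> all (<= x) s ->
  foldl vpurify z (x :: s) <= foldl vpurify z (rcons s x)
    ?= iff all (>= x) s.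
Proof.
move=> z0 x0; elim: s z z0 => [|y s IHs] z z0 /=.
  by move=> _ _; apply/leif_refl.
move=> /andP[y01 s01] /andP[leyx lesx]; have y0 := visibility_gt0 y01.
apply: leif_trans (IHs _ _ s01 lesx); last exact: vpurify_gt0.
apply/leifP; case: (ltgtP y x) leyx => // [ltyx _|-> //].
by apply: ltr_foldl_vpurify; rewrite ?posrE ?vpurify_gt0 // vpurify_swap.
Qed.

Definition vseq_purify s : R := if s is x :: s' then foldl vpurify x s' else 0.

Lemma vseq_purify_gt0 x s : all visibility (x :: s) -> 0 < vseq_purify (x :: s).
Proof.
case/andP=> /visibility_gt0 x0 /all_visibility_gt0.
exact: foldl_vpurify_gt0.
Qed.

Lemma vseq_purify_rcons x s y :
  vseq_purify (rcons (x :: s) y) = vpurify (vseq_purify (x :: s)) y.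
Proof. by rewrite /= foldl_rcons. Qed.

Lemma vseq_purify_rev_cons x y s :
  vseq_purify (rev (x :: y :: s)) = vpurify (vseq_purify (rev (y :: s))) x.
Proof.
rewrite rev_cons; case E: (rev _) => [|a t]; last exact: vseq_purify_rcons.
by have := congr1 size E; rewrite size_rev.
Qed.

Lemma vseq_purify_rev_gt0 x s : all visibility (x :: s) ->
  0 < vseq_purify (rev (x :: s)).
Proof.
rewrite -all_rev; case E: (rev _) => [|a t]; last exact: vseq_purify_gt0.
by have := congr1 size E; rewrite size_rev.
Qed.

Lemma vseq_purify_head_to_last x y s :
  all visibility (x :: y :: s) -> all (<= x) s ->
  vseq_purify (x :: y :: s) <= vpurify (vseq_purify (y :: s)) x
    ?= iff all (>= x) s.
Proof.
move=> /and3P[/visibility_gt0 x0 /visibility_gt0 y0 s01] lesx.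
rewrite -vseq_purify_rcons /= vpurifyC.
exact: foldl_vpurify_rcons.
Qed.

Lemma ler_vseq_purify_rev s : all visibility s -> sorted >=%R s ->
  vseq_purify s <= vseq_purify (rev s).
Proof.
elim: s => [|x [|y s] IHs] // xys01 xys_sorted.
have /andP[x01 ys01] := xys01.
have /andP[_ lesx] := order_path_min ge_trans xys_sorted.
rewrite vseq_purify_rev_cons //.
apply: le_trans (vseq_purify_head_to_last xys01 lesx) _.
apply: ler_vpurifyl; rewrite ?posrE ?vseq_purify_gt0 ?vseq_purify_rev_gt0 //.
exact: IHs (path_sorted xys_sorted).
Qed.

Lemma ltr_vseq_purify_rev x y s : all visibility (x :: y :: s) ->
  sorted >=%R (x :: y :: s) -> has (< x) s ->
  vseq_purify (x :: y :: s) < vseq_purify (rev (x :: y :: s)).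
Proof.
move=> xys01 xys_sorted ltsx; have /andP[x01 ys01] := xys01.
have /andP[_ lesx] := order_path_min ge_trans xys_sorted.
rewrite vseq_purify_rev_cons //.
apply: (@lt_le_trans _ _ (vpurify (vseq_purify (y :: s)) x)).
  rewrite (lt_leif (vseq_purify_head_to_last xys01 lesx)) -has_predC.
  by apply: sub_has ltsx => a /=; rewrite -ltNge.
apply: ler_vpurifyl; rewrite ?posrE ?vseq_purify_gt0 ?vseq_purify_rev_gt0 //.
exact: ler_vseq_purify_rev (path_sorted xys_sorted).
Qed.

Lemma seq_purify_isofid s : s != [::] -> all visibility s ->
  seq_purify (map isofid s) = isofid (vseq_purify s).
Proof.
case: s => //= x s _ /andP[/visibility_gt0 x0 /all_visibility_gt0 s0].
exact: foldl_purify.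
Qed.

Lemma SPF_lt_SPL x y s : all visibility (x :: y :: s) ->
  sorted >=%R (x :: y :: s) -> has (< x) s ->
  SPF (map isofid (x :: y :: s)) < SPL (map isofid (x :: y :: s)).
Proof.
move=> xys01 xys_sorted ltsx; rewrite /SPF /SPL -map_rev.
rewrite !seq_purify_isofid ?all_rev // ?ltr_isofid ?ltr_vseq_purify_rev //.
by rewrite -size_eq0 size_rev.
Qed.

End Visibility.

Theorem theorem1 (R : rcfType) (V : finType) (e : rel V)
  (e_sym : symmetric e) (e_irr : irreflexive e)
  (p : R) (p_gt0 : 0 < p) (p_lt1 : p < 1)
  (S T : V) (neqST : S != T)
  (n : nat) (n_ge3 : (3 <= n)%N)
  (r : n.-tuple (seq V))
  (r_path : forall i : 'I_n, is_path e S T (tnth r i))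
  (r_distinct : uniq r)
  (r_sorted : forall i j : 'I_n,
     (i <= j)%N -> (size (tnth r i) <= size (tnth r j))%N)
  (r_not_all_equal : exists i j : 'I_n,
     (size (tnth r i) < size (tnth r j))%N)
  (f_range : forall i : 'I_n,
     1 / 2 < path_fidelity p (tnth r i) < 1) :
  SPL [seq path_fidelity p x | x <- r] > SPF [seq path_fidelity p x | x <- r].
Proof.
have map_r : [seq path_fidelity p x | x <- r] =
    map (@isofid R) [seq p ^+ size x | x <- r].
  by rewrite -map_comp; apply: eq_map => x; rewrite /= path_fidelityE.
have r01 : all (@visibility R) [seq p ^+ size x | x <- r].
  rewrite all_map; apply/allP => _ /tnthP[i ->] /=.
  rewrite /visibility exprn_gt0 //= exprn_ilt1 ?ltW //.
  have /and3P[_ + _] := r_path i.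
  by case: (tnth r i) => //=; rewrite (negPf neqST).
have r_nth i j : (i <= j)%N -> (j < n)%N ->
    (size (nth [::] r i) <= size (nth [::] r j))%N.
  move=> leij ltjn; have ltin := leq_ltn_trans leij ltjn.
  have := r_sorted (Ordinal ltin) (Ordinal ltjn) leij.
  by rewrite !(tnth_nth [::]).
have rs : sorted >=%R [seq p ^+ size x | x <- r].
  rewrite sorted_map; apply/(sortedP [::]) => i; rewrite size_tuple => ltin.
  by rewrite /= ler_wiXn2l ?ltW ?r_nth.
have lt_r : (size (nth [::] r 0) < size (nth [::] r n.-1))%N.
  have [i [j ltij]] := r_not_all_equal.
  have n0 : (0 < n)%N by case: (n) n_ge3.
  have := r_nth 0 i (leq0n _) (ltn_ord i).
  have jn : (j <= n.-1)%N by rewrite -ltnS prednK.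
  have := r_nth _ _ jn; rewrite ltn_predL => /(_ n0).
  move: ltij; rewrite !(tnth_nth [::]) => ltij lej lei.
  exact: leq_ltn_trans lei (leq_trans ltij lej).
rewrite map_r; have := size_tuple r.
case: (tval r) r01 rs lt_r => [|x [|y s]] /= r01 rs lt_r sz;
  try by rewrite -sz in n_ge3.
apply: SPF_lt_SPL => //; rewrite has_map; apply/(has_nthP [::]).
rewrite -sz /= in lt_r n_ge3 *.
exists (size s).-1; first by case: (s) n_ge3.
case: (s) n_ge3 lt_r => //= z s' _ lt_r.
by rewrite ltr_iXn2l.
Qed.
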